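(* Let $(\mathcal C,\mathsf d_{\mathcal C})$ be a metric space. Assume that there exist a set $\mathcal X$ and a surjective function $[\cdot,\cdot]:\mathcal X\times[0,\infty)\to\mathcal C$ such that for all $x_0,x_1\in\mathcal X$ and $r_0,r_1\ge 0$ $$\mathsf d_{\mathcal C}^2([x_0,r_0],[x_1,r_1])=r_0r_1\,\mathsf d_{\mathcal C}^2([x_0,1],[x_1,1])+(r_0-r_1)^2,$$ and such that $$0<\mathsf d_{\mathcal C}^2([x_0,1],[x_1,1])\le 4\qquad\text{for all }x_0\ne x_1\in\mathcal X.$$ Then $\mathsf d_{\mathcal X}:\mathcal X\times\mathcal X\to[0,\infty)$ given by $$\mathsf d_{\mathcal X}(x_0,x_1)=\arccos\Big(1-\tfrac12\,\mathsf d_{\mathcal C}^2([x_0,1],[x_1,1])\Big)\in[0,\pi]$$ is a metric on $\mathcal X$, and $(\mathcal C,\mathsf d_{\mathcal C})$ is a metric cone over $(\mathcal X,\mathsf d_{\mathcal X})$, i.e. for all $x_0,x_1\in\mathcal X$ and $r_0,r_1\ge0$ $$\mathsf d_{\mathcal C}^2([x_0,r_0],[x_1,r_1])=r_0^2+r_1^2-2r_0r_1\cos_\pi\big(\mathsf d_{\mathcal X}(x_0,x_1)\big).$$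
   Context: Notation: $\cos_a(b):=\cos(\min\{a,b\})$. *)

(* Defs.v *)
From HB Require Import structures.
From mathcomp Require Import all_boot all_order all_algebra.
From mathcomp Require Import all_classical all_reals all_analysis.
Set Implicit Arguments.
Unset Strict Implicit.
Unset Printing Implicit Defensive.
Import Order.TTheory GRing.Theory Num.Theory.
Local Open Scope ring_scope.

(* [metricType] bundles a metric with the carrier; this predicate states the
   same axioms for a distance function on a bare type. *)
Record is_metric (R : realType) (X : Type) (d : X -> X -> R) : Prop := {
  is_metric_ge0 : forall x y, 0 <= d x y ;
  is_metric_eq0 : forall x y, d x y = 0 <-> x = y ;
  is_metric_sym : forall x y, d x y = d y x ;
  is_metric_triangle : forall y x z, d x z <= d x y + d y z }.

Definition cos_trunc (R : realType) (a b : R) : R := cos (Num.min a b).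

Definition cone_base_dist (R : realType) (C : metricType R) (X : Type)
    (br : X * {nonneg R} -> C) (x0 x1 : X) : R :=
  acos (1 - 2^-1 * mdist (br (x0, 1%:nng)) (br (x1, 1%:nng)) ^+ 2).

(* Main.v *)
(** Consider three points of the plane in the directions [0], [a] and [a + b],
    at distances [2 sin b], [sin (a + b)] and [2 sin a] from the origin: when
    [a + b < pi], the second is the midpoint of the other two. Comparing the
    triangle inequality of the cone at these radii with this collinear planar
    configuration gives [cos (a + b) <= cos c], which is the triangle inequality
    for angles. If [pi <= a + b], it holds because angles are at most [pi]. *)
Require Import Defs.
From HB Require Import structures.
From mathcomp Require Import all_boot all_order all_algebra.
From mathcomp Require Import all_classical all_reals all_analysis.
From mathcomp Require Import ring lra.
Set Implicit Arguments.
Unset Strict Implicit.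
Unset Printing Implicit Defensive.
Import Order.TTheory GRing.Theory Num.Theory.
Local Open Scope ring_scope.

(** A squared triangle inequality whose bound is attained when [u = v = d / 2], so it loses nothing
    at a midpoint. *)
Lemma sqr_le_double (R : realDomainType) (d u v : R) :
  0 <= d -> d <= u + v -> d ^+ 2 <= 2 * (u ^+ 2 + v ^+ 2).
Proof.
move=> d0 duv; have uv0 := le_trans d0 duv.
apply: (@le_trans _ _ ((u + v) ^+ 2)); first by rewrite ler_sqr.
have := sqr_ge0 (u - v); rewrite sqrrB sqrrD !mulr2n; lra.
Qed.

Lemma acos_eq0 (R : realType) (x : R) : -1 <= x <= 1 -> acos x = 0 <-> x = 1.
Proof.
move=> xI; split => [ax0|->]; last exact: acos1.
by rewrite -(acosK xI) ax0 cos0.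
Qed.

(** By the planar cosine law the two summands are squared distances from the midpoint to the outer
    points, each a quarter of the squared outer distance. With signed radii this holds for all
    angles. *)
Lemma midpoint_cosine_law (R : realType) (a b : R) :
  let ra := 2 * sin b in let rb := 2 * sin a in let t := sin (a + b) in
  2 * ((ra ^+ 2 + t ^+ 2 - 2 * ra * t * cos a)
     + (t ^+ 2 + rb ^+ 2 - 2 * t * rb * cos b))
  = ra ^+ 2 + rb ^+ 2 - 2 * ra * rb * cos (a + b).
Proof.
move=> /=; rewrite sinD cosD.
ring: (cos2sin2 a) (cos2sin2 b).
Qed.

Section ConeBase.
Variables (R : realType) (C : metricType R) (X : Type).
Variable br : X * {nonneg R} -> C.
Hypothesis br_dist : forall (x0 x1 : X) (r0 r1 : {nonneg R}),
  mdist (br (x0, r0)) (br (x1, r1)) ^+ 2 =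
  r0%:num * r1%:num * mdist (br (x0, 1%:nng)) (br (x1, 1%:nng)) ^+ 2
  + (r0%:num - r1%:num) ^+ 2.
Hypothesis br_bound : forall x0 x1 : X, x0 <> x1 ->
  0 < mdist (br (x0, 1%:nng)) (br (x1, 1%:nng)) ^+ 2 <= 4.

Local Notation chord2 x y := (mdist (br (x, 1%:nng)) (br (y, 1%:nng)) ^+ 2).
Local Notation angle := (cone_base_dist br).

(** Keeps the argument of [acos] in the range where [cos] inverts it; the bound 4 on squared chords
    is the end [-1]. *)
Lemma cone_cos_itv x y : -1 <= 1 - 2^-1 * chord2 x y <= 1.
Proof.
have [->|/br_bound] := pselect (x = y); last by lra.
by rewrite mdistxx; lra.
Qed.

Lemma cone_base_dist_itv x y : 0 <= angle x y <= pi.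
Proof. by rewrite acos_ge0 ?acos_lepi //; exact: cone_cos_itv. Qed.

Lemma cos_cone_base_dist x y : cos (angle x y) = 1 - 2^-1 * chord2 x y.
Proof. by rewrite acosK // in_itv; exact: cone_cos_itv. Qed.

Lemma cone_base_dist_eq0 x y : angle x y = 0 <-> x = y.
Proof.
split=> [/(acos_eq0 (cone_cos_itv x y)) c1|->].
  by have [//|/br_bound] := pselect (x = y) => chord; exfalso; lra.
by apply/(acos_eq0 (cone_cos_itv y y)); rewrite mdistxx; lra.
Qed.

Lemma cone_cosine_law x y (r s : {nonneg R}) :
  mdist (br (x, r)) (br (y, s)) ^+ 2 =
  r%:num ^+ 2 + s%:num ^+ 2 - 2 * r%:num * s%:num * cos (angle x y).
Proof. by rewrite br_dist cos_cone_base_dist; field. Qed.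

Lemma cos_cone_base_dist_triangle y x z :
  0 < angle x y -> 0 < angle y z -> angle x y + angle y z < pi ->
  cos (angle x y + angle y z) <= cos (angle x z).
Proof.
set a := angle x y; set b := angle y z => a0 b0 abpi.
have sa0 : 0 < sin a by apply: sin_gt0_pi; lra.
have sb0 : 0 < sin b by apply: sin_gt0_pi; lra.
have sab0 : 0 <= sin (a + b) by apply: sin_ge0_pi; lra.
have ra0 : 0 <= 2 * sin b by lra.
have rb0 : 0 <= 2 * sin a by lra.
pose ra := NngNum ra0; pose rb := NngNum rb0; pose t := NngNum sab0.
have tri : mdist (br (x, ra)) (br (z, rb)) ^+ 2 <=
    2 * (mdist (br (x, ra)) (br (y, t)) ^+ 2
       + mdist (br (y, t)) (br (z, rb)) ^+ 2).
  by apply: sqr_le_double; [exact: mdist_ge0|exact: metric_triangle].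
rewrite !cone_cosine_law midpoint_cosine_law /= -/a -/b in tri.
(* The squared radii cancel in [tri], leaving the two cosines, each with factor
   [- 8 * (sin a * sin b)]. *)
have sab : 0 < sin a * sin b by rewrite mulr_gt0.
by rewrite -(ler_pM2l sab); lra.
Qed.

Lemma cone_base_dist_triangle y x z : angle x z <= angle x y + angle y z.
Proof.
have /andP[a0 api] := cone_base_dist_itv x y.
have /andP[b0 bpi] := cone_base_dist_itv y z.
have /andP[c0 cpi] := cone_base_dist_itv x z.
have [/(le_trans cpi)//|abpi] := leP pi (angle x y + angle y z).
(* A zero angle makes an outer radius vanish, so the planar comparison says nothing; but then two
   points coincide. *)
have [/esym/cone_base_dist_eq0 xy|xy0] := eqVneq 0 (angle x y).
  by rewrite -xy in a0 *; lra.
have [/esym/cone_base_dist_eq0 yz|yz0] := eqVneq 0 (angle y z).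
  by rewrite -yz in b0 *; lra.
have := @cos_cone_base_dist_triangle y x z.
rewrite !lt_neqAle xy0 yz0 a0 b0 -lt_neqAle => /(_ isT isT abpi).
(* Both angles lie in [[0, pi]], where [cos] is strictly decreasing. *)
by rewrite leNgt ltr_cos ?in_itv /= -?leNgt //; lra.
Qed.

End ConeBase.

Theorem theorem2p2 (R : realType) (C : metricType R) (X : Type)
    (br : X * {nonneg R} -> C)
    (br_surj : forall c : C, exists p : X * {nonneg R}, br p = c)
    (br_dist : forall (x0 x1 : X) (r0 r1 : {nonneg R}),
      mdist (br (x0, r0)) (br (x1, r1)) ^+ 2 =
      r0%:num * r1%:num * mdist (br (x0, 1%:nng)) (br (x1, 1%:nng)) ^+ 2
      + (r0%:num - r1%:num) ^+ 2)
    (br_bound : forall x0 x1 : X, x0 <> x1 ->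
      0 < mdist (br (x0, 1%:nng)) (br (x1, 1%:nng)) ^+ 2 <= 4) :
  [/\ forall x0 x1 : X, 0 <= cone_base_dist br x0 x1 <= pi,
      is_metric (cone_base_dist br) &
      forall (x0 x1 : X) (r0 r1 : {nonneg R}),
        mdist (br (x0, r0)) (br (x1, r1)) ^+ 2 =
        r0%:num ^+ 2 + r1%:num ^+ 2
        - 2 * r0%:num * r1%:num * cos_trunc pi (cone_base_dist br x0 x1)].
Proof.
split.
- exact: cone_base_dist_itv.
- split=> [x y|x y|x y|y x z].
  + by have /andP[] := cone_base_dist_itv br_bound x y.
  + exact: cone_base_dist_eq0.
  + by rewrite /cone_base_dist metric_sym.
  + exact: cone_base_dist_triangle.
- move=> x0 x1 r0 r1; rewrite /cos_trunc min_r.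
    exact: cone_cosine_law.
  by have /andP[] := cone_base_dist_itv br_bound x0 x1.
Qed.
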